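(* Let $H$ be a bialgebra over a field $K$. For all natural numbers $n,m$, all permutations $\sigma \in S_n$ and $\tau \in S_m$, and all $h \in H$, we have $(h^\sigma)^\tau = h^{\sigma\cdot\tau}$.
   Context: For a natural number $n\ge 1$, $S_n$ is the group of permutations of $\{1,\ldots,n\}$. For $\sigma\in S_n$ and $h\in H$, the $\sigma$-th Sweedler power of $h$ is $h^\sigma := h_{(\sigma(1))}h_{(\sigma(2))}\cdots h_{(\sigma(n))}$, where $h_{(1)}\otimes\cdots\otimes h_{(n)}\in H^{\otimes n}$ is the image of $h$ under the iterated comultiplication (Sweedler notation; for $n=1$ this image is $h$ itself). That is, $h^\sigma$ is obtained by applying the iterated coproduct, permuting the tensor factors so that the $j$-th factor is the old $\sigma(j)$-th factor, and multiplying. For $\sigma\in S_n$ and $\tau\in S_m$, the element $\sigma\cdot\tau\in S_{mn}$ is the permutation defined by $(\sigma\cdot\tau)((i-1)n+j) = (\sigma(j)-1)m+\tau(i)$ for $i\in\{1,\ldots,m\}$ and $j\in\{1,\ldots,n\}$. *)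

(* Defs.v *)
From HB Require Import structures.
From mathcomp Require Import all_boot all_algebra perm.
From mathcomp Require Import boolp finmap monalg.

Set Implicit Arguments.
Unset Strict Implicit.
Unset Printing Implicit Defensive.

Import GRing.Theory.
Local Open Scope ring_scope.
Local Open Scope quotient_scope.

Definition tset (T : Type) (n : nat) (u : n.-tuple T) (i : 'I_n) (x : T) :
    n.-tuple T :=
  [tuple if j == i then x else tnth u j | j < n].

Definition multilinear (K : fieldType) (V W : lmodType K) (n : nat)
    (f : n.-tuple V -> W) : Prop :=
  forall (u : n.-tuple V) (i : 'I_n) (a : K) (x y : V),
    f (tset u i (a *: x + y)) = a *: f (tset u i x) + f (tset u i y).

(* [tpow n V] is the free module on n-tuples of vectors modulo the submodule
   spanned by the multilinearity relations. *)
Section TensorPower.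
Variables (K : fieldType) (n : nat) (V : lmodType K).

Let F : lmodType K := {malg K[n.-tuple V]}.

Definition trelator (u : n.-tuple V) (i : 'I_n) (a : K) (x y : V) : F :=
  << tset u i (a *: x + y) >> - (a *: << tset u i x >> + << tset u i y >>).

Definition trel : {pred F} := fun g =>
  `[< forall P : {pred F}, submod_closed P ->
        (forall u i a x y, trelator u i a x y \in P) -> g \in P >].

Lemma trel_submod : submod_closed trel.
Proof.
split; first by apply/asboolP => P [P0 _] _.
move=> a x y /asboolP xP /asboolP yP; apply/asboolP => P PP rP.
by case: (PP) => _; apply; [apply: xP|apply: yP].
Qed.

HB.instance Definition _ := GRing.isSubmodClosed.Build K F trel trel_submod.

Definition tpow := Quotient.quot trel.

HB.instance Definition _ := GRing.Zmodule.on tpow.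
HB.instance Definition _ := ZmodQuotient.on tpow.

Definition tscale (a : K) : tpow -> tpow := lift_op1 tpow ( *:%R a).

Lemma pi_tscale (a : K) : {morph \pi_tpow : x / a *: x >-> tscale a x}.
Proof.
move=> x; unlock tscale; apply/eqP.
rewrite -Quotient.idealrBE -scalerBr rpredZ //.
by rewrite Quotient.idealrBE reprK.
Qed.

Lemma tscaleA a b x : tscale a (tscale b x) = tscale (a * b) x.
Proof. by rewrite -[x]reprK -!pi_tscale scalerA. Qed.

Lemma tscale1 : left_id 1 tscale.
Proof. by move=> x; rewrite -[x]reprK -pi_tscale scale1r. Qed.

Lemma tscaleDr : right_distributive tscale +%R.
Proof.
move=> a x y; rewrite -[x]reprK -[y]reprK -raddfD -!pi_tscale.
by rewrite scalerDr raddfD.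
Qed.

Lemma tscaleDl x : {morph tscale^~ x : a b / a + b}.
Proof. by move=> a b; rewrite -[x]reprK -!pi_tscale -raddfD -scalerDl. Qed.

HB.instance Definition _ := GRing.Zmodule_isLmodule.Build K tpow
  tscaleA tscale1 tscaleDr tscaleDl.

Lemma tpow_piZ a (x : F) : \pi_tpow (a *: x) = a *: \pi_tpow x.
Proof. exact: pi_tscale. Qed.

Definition tpure (u : n.-tuple V) : tpow := \pi_tpow << u >>.

(* The linear map induced by f; it is only meaningful for multilinear f, since
   otherwise the value depends on the chosen representative [repr x]. *)
Definition tlift (W : lmodType K) (f : n.-tuple V -> W) (x : tpow) : W :=
  \sum_(u <- msupp (repr x)) (repr x)@_u *: f u.

End TensorPower.

Section TensorPowerTheory.
Variables (K : fieldType) (n : nat) (V : lmodType K).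

Definition mext (W : lmodType K) (f : n.-tuple V -> W)
    (g : {malg K[n.-tuple V]}) : W :=
  \sum_(u <- msupp g) g@_u *: f u.

Lemma mextEw (W : lmodType K) (f : n.-tuple V -> W) g (d : {fset n.-tuple V}) :
  (msupp g `<=` d)%fset -> mext f g = \sum_(u <- d) g@_u *: f u.
Proof.
move=> gd; rewrite /mext (big_fset_incl _ gd) //= => u _ /mcoeff_outdom ->.
by rewrite scale0r.
Qed.

Lemma mext_linear (W : lmodType K) (f : n.-tuple V -> W) : linear (mext f).
Proof.
move=> a x y; pose d := (msupp x `|` msupp y `|` msupp (a *: x + y))%fset.
rewrite !(@mextEw _ _ _ d) /d ?fsubsetUr //.
- rewrite scaler_sumr -big_split /=; apply: eq_bigr => u _.
  by rewrite mcoeffD mcoeffZ scalerDl scalerA.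
- by rewrite -fsetUA fsetUCA fsubsetUl.
- by rewrite -fsetUA fsubsetUl.
Qed.

Lemma mextU (W : lmodType K) (f : n.-tuple V -> W) u : mext f << u >> = f u.
Proof.
rewrite (@mextEw _ _ _ [fset u]%fset) ?msuppU_le //.
by rewrite big_seq_fset1 mcoeffUU scale1r.
Qed.

Lemma mext_trel (W : lmodType K) (f : n.-tuple V -> W) g :
  multilinear f -> g \in @trel K n V -> mext f g = 0.
Proof.
move=> fM /asboolP/(_ (fun g => mext f g == 0)) H; apply/eqP/H => {g H}.
  split=> [|a x y].
    by rewrite unfold_in /mext msupp0 big_seq_fset0.
  by rewrite !unfold_in mext_linear => /eqP-> /eqP->; rewrite scaler0 addr0.
move=> u i a x y; rewrite unfold_in /trelator addrC.
rewrite -scaleN1r mext_linear mext_linear !mextU fM scaleN1r.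
by rewrite addNr.
Qed.

Lemma tlift_pi (W : lmodType K) (f : n.-tuple V -> W) g :
  multilinear f -> tlift f (\pi_(tpow n V) g) = mext f g.
Proof.
move=> fM; set h := repr (\pi_(tpow n V) g).
suff hg: h - g \in @trel K n V.
  have := mext_trel fM hg; rewrite addrC -scaleN1r mext_linear scaleN1r.
  by move/eqP; rewrite addrC subr_eq0 => /eqP.
by rewrite Quotient.idealrBE reprK.
Qed.

Lemma tlift_tpure (W : lmodType K) (f : n.-tuple V -> W) u :
  multilinear f -> tlift f (tpure u) = f u.
Proof. by move=> fM; rewrite tlift_pi // mextU. Qed.

Lemma tlift_linear (W : lmodType K) (f : n.-tuple V -> W) :
  multilinear f -> linear (tlift f).
Proof.
move=> fM a x y; rewrite -[x]reprK -[y]reprK -tpow_piZ -raddfD !tlift_pi //.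
exact: mext_linear.
Qed.

Lemma tpure_multilinear : multilinear (@tpure K n V).
Proof.
move=> u i a x y; apply/eqP.
rewrite -tpow_piZ -raddfD -Quotient.idealrBE; apply/asboolP => P _; exact.
Qed.

Lemma tpow_span (x : tpow n V) :
  exists s : seq (K * n.-tuple V), x = \sum_(p <- s) p.1 *: tpure p.2.
Proof.
exists [seq ((repr x)@_u, u) | u <- msupp (repr x)].
rewrite big_map -[LHS]reprK {1}[repr x]monalgE raddf_sum /=.
apply: eq_bigr => u _; rewrite -tpow_piZ; congr (\pi _).
by apply/malgP => v; rewrite mcoeffZ !mcoeffU mulrnAr mulr1.
Qed.

Lemma tlift_sum (W : lmodType K) (f : n.-tuple V -> W)
    (s : seq (K * n.-tuple V)) : multilinear f ->
  tlift f (\sum_(p <- s) p.1 *: tpure p.2) = \sum_(p <- s) p.1 *: f p.2.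
Proof.
move=> fM; have L := tlift_linear fM.
elim: s => [|p s IHs]; last by rewrite !big_cons L IHs tlift_tpure.
rewrite !big_nil; apply: (addIr (tlift f 0)).
by have := L 1 0 0; rewrite !scale1r !add0r => <-.
Qed.

End TensorPowerTheory.

Section TensorOperations.
Variables (K : fieldType).

(* Juxtaposition of tensors,
   (u_1 # ... # u_m, v_1 # ... # v_n) |-> u_1 # ... # u_m # v_1 # ... # v_n
   where # stands for the tensor product. *)
Definition tcat (V : lmodType K) (m n : nat) (x : tpow m V) (y : tpow n V) :
    tpow (m + n) V :=
  tlift (fun u => tlift (fun v => tpure [tuple of u ++ v]) y) x.

(* The product of the algebra H # ... # H, which is componentwise on pure
   tensors. *)
Definition tmul (H : algType K) (n : nat) (x y : tpow n H) : tpow n H :=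
  tlift (fun u =>
    tlift (fun v => tpure [tuple tnth u i * tnth v i | i < n]) y) x.

Lemma multilinear_tliftr (V V' W : lmodType K) m n
    (f : m.-tuple V -> n.-tuple V' -> W) (y : tpow n V') :
    (forall u, multilinear (f u)) -> (forall v, multilinear (f^~ v)) ->
  multilinear (fun u => tlift (f u) y).
Proof.
move=> fMr fMl u i a x x'; have [s ->] := tpow_span y.
rewrite !tlift_sum // scaler_sumr -big_split; apply: eq_bigr => p _ /=.
by rewrite fMl scalerDr !scalerA mulrC.
Qed.

Lemma tset_catl (T : Type) m n (u : m.-tuple T) (v : n.-tuple T) i x :
  [tuple of tset u i x ++ v] = tset [tuple of u ++ v] (lshift n i) x.
Proof.
apply: eq_from_tnth => j; rewrite tnth_mktuple.
case: (splitP j) => k jk.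
  have -> : j = lshift n k by apply: val_inj.
  by rewrite !tnth_lshift tnth_mktuple (inj_eq (@lshift_inj _ _)).
have -> : j = rshift m k by apply: val_inj.
by rewrite !tnth_rshift eq_rlshift.
Qed.

Lemma tset_catr (T : Type) m n (u : m.-tuple T) (v : n.-tuple T) i x :
  [tuple of u ++ tset v i x] = tset [tuple of u ++ v] (rshift m i) x.
Proof.
apply: eq_from_tnth => j; rewrite tnth_mktuple.
case: (splitP j) => k jk.
  have -> : j = lshift n k by apply: val_inj.
  by rewrite !tnth_lshift eq_lrshift.
have -> : j = rshift m k by apply: val_inj.
by rewrite !tnth_rshift tnth_mktuple (inj_eq (@rshift_inj _ _)).
Qed.

Lemma tpure_cat_multilinearr (V : lmodType K) m n (u : m.-tuple V) :
  multilinear (fun v : n.-tuple V => tpure [tuple of u ++ v]).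
Proof. by move=> ? ? ? ? ?; rewrite !tset_catr tpure_multilinear. Qed.

Lemma tpure_cat_multilinearl (V : lmodType K) m n (v : n.-tuple V) :
  multilinear (fun u : m.-tuple V => tpure [tuple of u ++ v]).
Proof. by move=> ? ? ? ? ?; rewrite !tset_catl tpure_multilinear. Qed.

Lemma tcat_tpure (V : lmodType K) m n (u : m.-tuple V) (v : n.-tuple V) :
  tcat (tpure u) (tpure v) = tpure [tuple of u ++ v].
Proof.
have M := multilinear_tliftr (tpure v) (@tpure_cat_multilinearr _ m n)
  (@tpure_cat_multilinearl _ m n).
rewrite /tcat (tlift_tpure _ M).
exact: (tlift_tpure _ (@tpure_cat_multilinearr _ m n u)).
Qed.

Lemma tmul_tpure (H : algType K) n (u v : n.-tuple H) :
  tmul (tpure u) (tpure v) = tpure [tuple tnth u i * tnth v i | i < n].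
Proof.
pose m2 (u v : n.-tuple H) := [tuple tnth u i * tnth v i | i < n].
have m2r w w' i x : m2 w (tset w' i x) = tset (m2 w w') i (tnth w i * x).
  apply: eq_from_tnth => j; rewrite !tnth_mktuple.
  by case: eqP => [->|].
have m2l w w' i x : m2 (tset w i x) w' = tset (m2 w w') i (x * tnth w' i).
  apply: eq_from_tnth => j; rewrite !tnth_mktuple.
  by case: eqP => [->|].
have fMr w : multilinear (fun v => tpure (m2 w v)).
  move=> w' i a x y; rewrite !m2r mulrDr -scalerAr.
  exact: tpure_multilinear.
have fMl w : multilinear (fun u => tpure (m2 u w)).
  move=> w' i a x y; rewrite !m2l mulrDl -scalerAl.
  exact: tpure_multilinear.
rewrite /tmul (tlift_tpure _ (multilinear_tliftr _ fMr fMl)).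
exact: (tlift_tpure _ (fMr u)).
Qed.

End TensorOperations.

(* With D the comultiplication and e the counit: coassociativity is
   (D # id) D = (id # D) D, and the counit axioms are
   (e # id) D = id = (id # e) D. That e is a morphism of algebras is part of its
   type. *)
HB.mixin Record Algebra_isBialgebra (K : fieldType) (H : Type)
    of GRing.Algebra K H := {
  comul : {linear H -> tpow 2 H};
  counit : {lrmorphism H -> K^o};
  comulA : forall h : H,
    tlift (fun u => tcat (comul (tnth u ord0)) (tpure [tuple tnth u ord_max]))
      (comul h)
    = tlift (fun u => tcat (tpure [tuple tnth u ord0]) (comul (tnth u ord_max)))
      (comul h) :> tpow 3 H;
  counitl : forall h : H,
    tlift (fun u => (counit (tnth u ord0) : K) *: tnth u ord_max) (comul h) = h;
  counitr : forall h : H,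
    tlift (fun u => (counit (tnth u ord_max) : K) *: tnth u ord0) (comul h) = h;
  comul1 : comul 1 = tpure [tuple 1; 1];
  comulM : forall g h : H, comul (g * h) = tmul (comul g) (comul h)
}.

#[short(type="bialgType")]
HB.structure Definition Bialgebra (K : fieldType) :=
  {H of Algebra_isBialgebra K H & GRing.Algebra K H}.

Section SweedlerPower.
Variables (K : fieldType) (H : bialgType K).

(* h |-> h_(1) # ... # h_(k + 1): the comultiplication is applied k times, each
   time to the first tensor factor. *)
Fixpoint icomulS (k : nat) (h : H) : tpow k.+1 H :=
  match k with
  | 0 => tpure [tuple h]
  | k'.+1 =>
      tlift (fun u : k'.+1.-tuple H =>
        tcat (comul (thead u)) (tpure [tuple of behead u])) (icomulS k' h)
  end.

Definition icomul (n : nat) (h : H) : tpow n H :=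
  match n with
  | 0 => (counit h : K) *: tpure [tuple]
  | k.+1 => icomulS k h
  end.

(* 'S_n acts on {0, ..., n - 1}. *)
Definition sweedler_power (n : nat) (s : 'S_n) (h : H) : H :=
  tlift (fun u : n.-tuple H => \prod_(j < n) tnth u (s j)) (icomul n h).

End SweedlerPower.

(* The maps lifted above are multilinear, so that all these uses of [tlift] are
   meaningful. *)
Section Multilinearity.
Variables (K : fieldType) (H : bialgType K).

Lemma tcat_linearl (V : lmodType K) m n (y : tpow n V) :
  linear (fun x : tpow m V => tcat x y).
Proof.
apply/tlift_linear/multilinear_tliftr => [u|v].
  exact: tpure_cat_multilinearr.
exact: tpure_cat_multilinearl.
Qed.

Lemma tcat_linearr (V : lmodType K) m n (x : tpow m V) :
  linear (fun y : tpow n V => tcat x y).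
Proof.
move=> a y y'; have [s ->] := tpow_span x.
have M := multilinear_tliftr _ (@tpure_cat_multilinearr _ V m n)
  (@tpure_cat_multilinearl _ V m n).
have E z := tlift_sum s (M z).
apply: (etrans (E _)); symmetry.
apply: (etrans (congr2 (fun w w' => a *: w + w') (E y) (E y'))); symmetry.
rewrite scaler_sumr -big_split; apply: eq_bigr => p _ /=.
have L := tlift_linear (@tpure_cat_multilinearr _ V m n p.2).
apply: (etrans (congr1 (fun w => p.1 *: w) (L a y y'))).
by rewrite scalerDr !scalerA mulrC.
Qed.

Lemma comul_tcat_multilinear n : multilinear (fun u : n.+1.-tuple H =>
  tcat (comul (thead u)) (tpure [tuple of behead u])).
Proof.
move=> u i a x y; rewrite /thead !tnth_mktuple.
have tE (z : H) : [tuple of behead (tset u i z)] =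
    if unlift ord0 i is Some j then tset [tuple of behead u] j z
    else [tuple of behead u].
  apply: eq_from_tnth => j; rewrite tnth_behead tnth_mktuple.
  have -> : inord j.+1 = lift ord0 j :> 'I_n.+1.
    by apply: val_inj; rewrite /= inordK // ltnS.
  case: unliftP => [k ->|->]; last first.
    rewrite tnth_behead -val_eqE /=; congr (tnth u _).
    by apply: val_inj; rewrite /= inordK // ltnS.
  rewrite tnth_mktuple (inj_eq (@lift_inj _ _)) tnth_behead.
  case: eqP => // _; congr (tnth u _).
  by apply: val_inj; rewrite /= inordK // ltnS.
rewrite !tE; case: unliftP => [k ->|->].
  rewrite !(negbTE (neq_lift ord0 k)) tpure_multilinear.
  exact: tcat_linearr.
rewrite eqxx linearP; exact: tcat_linearl.
Qed.

Lemma ord2P (i : 'I_2) : i = ord0 \/ i = ord_max.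
Proof. by case: i => [[|[|]] ?] //; [left|right]; apply: val_inj. Qed.

Lemma comulA_multilinear :
  multilinear (fun u : 2.-tuple H =>
    tcat (comul (tnth u ord0)) (tpure [tuple tnth u ord_max])) /\
  multilinear (fun u : 2.-tuple H =>
    tcat (tpure [tuple tnth u ord0]) (comul (tnth u ord_max))).
Proof.
have tE (x : H) : [tuple x] = tset [tuple 0] ord0 x.
  by apply: eq_from_tnth => j; rewrite (ord1 j) tnth_mktuple.
have tL a (x y : H) :
    tpure [tuple a *: x + y] = a *: tpure [tuple x] + tpure [tuple y].
  by rewrite (tE (_ + _)) tpure_multilinear -!tE.
split=> u i a x y; rewrite !tnth_mktuple; case: (ord2P i) => -> /=.
- rewrite linearP; exact: tcat_linearl.
- rewrite tL; exact: tcat_linearr.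
- rewrite tL; exact: tcat_linearl.
- rewrite linearP; exact: tcat_linearr.
Qed.

Lemma counit_multilinear :
  multilinear (fun u : 2.-tuple H =>
    (counit (tnth u ord0) : K) *: tnth u ord_max) /\
  multilinear (fun u : 2.-tuple H =>
    (counit (tnth u ord_max) : K) *: tnth u ord0).
Proof.
split=> u i a x y; rewrite !tnth_mktuple; case: (ord2P i) => -> /=.
- by rewrite linearP scalerDl -scalerA.
- by rewrite scalerDr !scalerA mulrC.
- by rewrite scalerDr !scalerA mulrC.
- by rewrite linearP scalerDl -scalerA.
Qed.

Lemma sweedler_prod_multilinear n (s : 'S_n) :
  multilinear (fun u : n.-tuple H => \prod_(j < n) tnth u (s j)).
Proof.
move=> u i a x y; pose F (z : H) j := tnth (tset u i z) (s j).
have FE z j : F z j = if s j == i then z else tnth u (s j).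
  by rewrite /F tnth_mktuple.
pose k := (s^-1)%g i; have sk : s k = i by rewrite permKV.
suff L (r : seq 'I_n) : uniq r -> k \in r ->
    \prod_(j <- r) F (a *: x + y) j =
      a *: \prod_(j <- r) F x j + \prod_(j <- r) F y j.
  by apply: L; rewrite ?index_enum_uniq ?mem_index_enum.
have FN z j : j != k -> F z j = tnth u (s j).
  by move=> jk; rewrite FE -sk (inj_eq perm_inj) (negPf jk).
elim: r => //= j r IHr /andP[jr ur]; rewrite inE !big_cons.
case: (eqVneq k j) => [kj _|kj /= kr]; last first.
  by rewrite !FN 1?eq_sym // IHr // mulrDr scalerAr.
have E z : \prod_(l <- r) F z l = \prod_(l <- r) tnth u (s l).
  apply: eq_big_seq => l lr; rewrite FN //.
  by apply: contraNneq jr => lk; rewrite -kj -lk.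
by rewrite !E !FE -kj sk eqxx mulrDl scalerAl.
Qed.

End Multilinearity.

Section PermProduct.
Variables (n m : nat) (s : 'S_n) (t : 'S_m).

Lemma quo_ord_proof (k : 'I_(m * n)) : (k %/ n < m)%N.
Proof.
by case: n k => [|n'] k; [case: k => k; rewrite muln0|rewrite ltn_divLR].
Qed.

Lemma rem_ord_proof (k : 'I_(m * n)) : (k %% n < n)%N.
Proof.
by case: n k => [|n'] k; [case: k => k; rewrite muln0|rewrite ltn_mod].
Qed.

Definition quo_ord k := Ordinal (quo_ord_proof k).
Definition rem_ord k := Ordinal (rem_ord_proof k).

Lemma perm_dot_proof (k : 'I_(m * n)) :
  (s (rem_ord k) * m + t (quo_ord k) < m * n)%N.
Proof.
rewrite [ltnRHS]mulnC; apply: (@leq_trans ((s (rem_ord k)).+1 * m)%N).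
  by rewrite mulSn [leqRHS]addnC ltn_add2l.
by rewrite leq_mul2r ltn_ord orbT.
Qed.

Definition perm_dot_fun k := Ordinal (perm_dot_proof k).

Lemma perm_dot_inj : injective perm_dot_fun.
Proof.
move=> k k' /(congr1 val) /= E.
have m0 : (0 < m)%N by apply: leq_ltn_trans (ltn_ord (quo_ord k)).
have Eq : quo_ord k = quo_ord k'.
  apply/(@perm_inj _ t)/val_inj; move/(congr1 (modn^~ m)): E.
  by rewrite !modnMDl !modn_small.
have Er : rem_ord k = rem_ord k'.
  apply/(@perm_inj _ s)/val_inj; move/(congr1 (divn^~ m)): E.
  by rewrite !divnMDl // !divn_small // !addn0.
apply: val_inj; rewrite /= (divn_eq k n) (divn_eq k' n).
by move: Eq Er => /(congr1 val) /= -> /(congr1 val) /= ->.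
Qed.

(* In terms of 0-based indices, i * n + j |-> s j * m + t i. *)
Definition perm_dot : 'S_(m * n) := perm perm_dot_inj.

Lemma perm_dotE (k : 'I_(m * n)) (i : 'I_m) (j : 'I_n) :
  k = (i * n + j)%N :> nat -> perm_dot k = (s j * m + t i)%N :> nat.
Proof.
move=> kE; rewrite permE /=.
have n0 : (0 < n)%N by apply: leq_ltn_trans (ltn_ord j).
have -> : quo_ord k = i.
  by apply: val_inj; rewrite /= kE divnMDl // divn_small // addn0.
have -> // : rem_ord k = j.
by apply: val_inj; rewrite /= kE modnMDl modn_small.
Qed.

End PermProduct.

(* Main.v *)
(* In Sweedler notation, write h_(1) # ... # h_(n) for the iterated coproduct of
   h. By coassociativity and the counit axioms, applying the m-fold coproduct to
   each h_(j) and juxtaposing the results yields the (n * m)-fold coproduct of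
   h. On the other hand the m-fold coproduct is multiplicative, so that of
   h^s = h_(s 1) ... h_(s n) is the componentwise product of the m-fold
   coproducts of the h_(s j). Hence (h^s)^t is the product, over i and then j,
   of the component t i of the block s j of the (n * m)-fold coproduct, and the
   position of that component is the image of (i, j) under s . t. *)
Require Import Defs.
From mathcomp Require Import all_boot all_algebra perm.

Set Implicit Arguments.
Unset Strict Implicit.
Unset Printing Implicit Defensive.

Import GRing.Theory.
Local Open Scope ring_scope.

(** * Updates and maps of tuples, relative to the head *)

Section TupleCons.
Variables (T : Type) (n : nat).
Implicit Types (x y : T) (u : n.-tuple T).

Lemma tset_cons0 x y u :
  tset [tuple of x :: u] ord0 y = [tuple of y :: u].
Proof.
apply: eq_from_tnth => j; rewrite tnth_mktuple.
by case: (unliftP ord0 j) => [k ->|->]; rewrite ?eqxx // !tnthS.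
Qed.

Lemma tset_consS x y u i :
  tset [tuple of x :: u] (lift ord0 i) y = [tuple of x :: tset u i y].
Proof.
apply: eq_from_tnth => j; rewrite tnth_mktuple.
case: (unliftP ord0 j) => [k ->|->]; last by rewrite (negPf (neq_lift _ _)).
by rewrite (inj_eq (@lift_inj _ _)) !tnthS tnth_mktuple.
Qed.

Lemma behead_cons x u : [tuple of behead [tuple of x :: u]] = u.
Proof. exact: val_inj. Qed.

Lemma cat1_tuple x u :
  [tuple of [tuple x] ++ u] = [tuple of x :: u] :> n.+1.-tuple T.
Proof. exact: val_inj. Qed.

Lemma map_tset (T' : Type) (f : T -> T') u i x :
  [tuple of map f (tset u i x)] = tset [tuple of map f u] i (f x).
Proof.
by apply: eq_from_tnth => j; rewrite tnth_map !tnth_mktuple tnth_map; case: eqP.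
Qed.

End TupleCons.

(** * Stability properties of linear and multilinear maps *)

Section Multilinear.
Variables (K : fieldType) (V W : lmodType K).

(** An update hits either the head or the tail, so the two hypotheses cover all slots. This is the
    form needed for maps defined by recursion on tuples. *)
Lemma multilinear_cons n (g : V -> n.-tuple V -> W) :
    (forall x, multilinear (g x)) -> (forall v, linear (g^~ v)) ->
  multilinear (fun u : n.+1.-tuple V => g (thead u) [tuple of behead u]).
Proof.
move=> gM gL u i a x y; rewrite (tuple_eta u).
case: (unliftP ord0 i) => [j ->|->];
  rewrite ?tset_consS ?tset_cons0 !behead_cons.
  exact: gM.
exact: gL.
Qed.

Lemma multilinear0 (g : 0.-tuple V -> W) : multilinear g.
Proof. by move=> u []. Qed.

Lemma multilinear_consr n (f : n.+1.-tuple V -> W) x :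
  multilinear f -> multilinear (fun u : n.-tuple V => f [tuple of x :: u]).
Proof. by move=> fM u i a y z; rewrite -!tset_consS fM. Qed.

Lemma multilinear_consl n (f : n.+1.-tuple V -> W) (u : n.-tuple V) :
  multilinear f -> linear (fun x : V => f [tuple of x :: u]).
Proof.
(* The head [0] is a placeholder that [tset] overwrites. *)
move=> fM a x y; have := fM [tuple of 0 :: u] ord0 a x y.
by rewrite !tset_cons0.
Qed.

Lemma multilinear_map (U : lmodType K) n (g : U -> V) (f : n.-tuple V -> W) :
  linear g -> multilinear f -> multilinear (fun u => f [tuple of map g u]).
Proof. by move=> gL fM u i a x y; rewrite !map_tset gL fM. Qed.

Lemma multilinear2 (B : V -> V -> W) :
    (forall x, linear (B x)) -> (forall y, linear (B^~ y)) ->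
  multilinear (fun u : 2.-tuple V => B (tnth u ord0) (tnth u ord_max)).
Proof.
move=> Br Bl u i a x y; rewrite !tnth_mktuple.
by case: (ord2P i) => ->; [exact: Bl|exact: Br].
Qed.

Lemma linear_comp (U : lmodType K) (f : V -> W) (g : U -> V) :
  linear f -> linear g -> linear (fun x => f (g x)).
Proof. by move=> fL gL a x y; rewrite gL fL. Qed.

Lemma linear_scale (f : V -> W) a x : linear f -> f (a *: x) = a *: f x.
Proof. by move=> fL; exact: (scalable_linear fL). Qed.

Lemma linear_lincomb (I : Type) (f : V -> W) (r : seq I) (c : I -> K)
    (x : I -> V) : linear f ->
  f (\sum_(i <- r) c i *: x i) = \sum_(i <- r) c i *: f (x i).
Proof.
move=> fL; elim: r => [|i r IHr]; last by rewrite !big_cons fL IHr.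
by rewrite !big_nil -[X in f X](scale0r 0) linear_scale // scale0r.
Qed.

End Multilinear.

(** * The universal property of tensor powers *)

Section TensorLift.
Variables (K : fieldType) (V W : lmodType K).

(** Pure tensors span. Most tensor identities below are reduced to tuples in this way, one variable
    at a time. *)
Lemma tpow_ext n (f g : tpow n V -> W) : linear f -> linear g ->
  (forall u, f (tpure u) = g (tpure u)) -> f =1 g.
Proof.
move=> fL gL fg x; have [s ->] := tpow_span x.
by rewrite !linear_lincomb //; apply: eq_bigr => p _; rewrite fg.
Qed.

Lemma eq_tlift n (f g : n.-tuple V -> W) x : f =1 g -> tlift f x = tlift g x.
Proof. by move=> fg; apply: eq_bigr => u _; rewrite fg. Qed.

(** With [x] fixed, [tlift] is a finite sum over one chosen representative, so linearity in the
    parameter holds term by term. *)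
Lemma tlift_param (U : lmodType K) n (f : U -> n.-tuple V -> W) x :
  (forall u, linear (f^~ u)) -> linear (fun y => tlift (f y) x).
Proof.
move=> fL a y z; rewrite scaler_sumr -big_split; apply: eq_bigr => u _ /=.
by rewrite fL scalerDr !scalerA mulrC.
Qed.

Lemma tlift_comp (U : lmodType K) n (f : W -> U) (g : n.-tuple V -> W) x :
  linear f -> f (tlift g x) = tlift (fun u => f (g u)) x.
Proof. by move=> fL; apply: linear_lincomb. Qed.

(** Uniqueness in the universal property: a linear map is the lift of its restriction to pure
    tensors. *)
Lemma tlift_pure n (f : tpow n V -> W) x :
  linear f -> tlift (fun u => f (tpure u)) x = f x.
Proof.
move=> fL; move: x; apply: tpow_ext => // [|u].
  by apply/tlift_linear => u i a x y; rewrite tpure_multilinear fL.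
by rewrite tlift_tpure // => v i a x y; rewrite tpure_multilinear fL.
Qed.

(** Induction on [n]: with the tail frozen, [tpow_ext] makes the head pure; with that pure head
    frozen, the induction hypothesis treats the tail. *)
Lemma multilinear_ext n k (f g : n.-tuple (tpow k V) -> W) :
    multilinear f -> multilinear g ->
    (forall u : n.-tuple (k.-tuple V),
      f [tuple of map (@tpure K k V) u] = g [tuple of map (@tpure K k V) u]) ->
  f =1 g.
Proof.
elim: n f g => [|n IHn] f g fM gM fg x.
  by have := fg [tuple]; rewrite !(tuple0 [tuple of map _ _]) (tuple0 x).
rewrite (tuple_eta x).
pose f' y := f [tuple of y :: behead x].
pose g' y := g [tuple of y :: behead x].
suff: f' =1 g' by apply.
apply: tpow_ext; try exact: multilinear_consl.
move=> u; rewrite /f' /g'.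
pose h (f : n.+1.-tuple (tpow k V) -> W) (w : n.-tuple (tpow k V)) :=
  f [tuple of tpure u :: w].
apply: (IHn (h f) (h g)); try exact: multilinear_consr.
move=> v; have := fg [tuple of u :: v].
suff -> : [tuple of map (@tpure K k V) [tuple of u :: v]] =
  [tuple of tpure u :: [tuple of map (@tpure K k V) v]] by [].
exact: val_inj.
Qed.

Lemma tlift_catl m n (f : (m + n).-tuple V -> W) u (y : tpow n V) :
    multilinear f ->
  tlift f (tcat (tpure u) y) = tlift (fun v => f [tuple of u ++ v]) y.
Proof.
move=> fM.
have fuM : multilinear (fun v : n.-tuple V => f [tuple of u ++ v]).
  by move=> v i a z z'; rewrite !tset_catr fM.
move: y; apply: tpow_ext => [||v].
- exact/(linear_comp (tlift_linear fM))/tcat_linearr.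
- exact: tlift_linear.
- by rewrite tcat_tpure !tlift_tpure.
Qed.

Lemma tlift_catr m n (f : (m + n).-tuple V -> W) (x : tpow m V) v :
    multilinear f ->
  tlift f (tcat x (tpure v)) = tlift (fun u => f [tuple of u ++ v]) x.
Proof.
move=> fM.
have fvM : multilinear (fun u : m.-tuple V => f [tuple of u ++ v]).
  by move=> u i a z z'; rewrite !tset_catl fM.
move: x; apply: tpow_ext => [||u].
- exact/(linear_comp (tlift_linear fM))/tcat_linearl.
- exact: tlift_linear.
- by rewrite tcat_tpure !tlift_tpure.
Qed.

End TensorLift.

(** * Unit and associativity of juxtaposition *)

Section TensorConcatenation.
Variables (K : fieldType) (V : lmodType K).

Lemma tcat0l n (x : tpow n V) : tcat (tpure [tuple]) x = x.
Proof.
move: x; apply: tpow_ext => [||u] //; first exact: tcat_linearr.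
by rewrite tcat_tpure; congr tpure; apply: val_inj.
Qed.

(** With a first block of length 1, the lengths [1 + m + n] and [1 + (m + n)] are convertible, so
    both sides have the same type without a cast. *)
Lemma tcat1A m n u (y : tpow m V) (z : tpow n V) :
  tcat (tcat (tpure u : tpow 1 V) y) z = tcat (tpure u : tpow 1 V) (tcat y z).
Proof.
move: y; apply: tpow_ext => [||v].
- exact: (linear_comp (tcat_linearl _) (tcat_linearr _)).
- exact: (linear_comp (f := tcat (tpure u)) (tcat_linearr _) (tcat_linearl z)).
move: z; apply: tpow_ext => [||w].
- exact: tcat_linearr.
- exact: (linear_comp (f := tcat (tpure u)) (tcat_linearr _) (tcat_linearr _)).
rewrite !tcat_tpure; apply: (congr1 (@tpure K _ V)).
by apply: val_inj; rewrite /= catA.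
Qed.

End TensorConcatenation.

(** * The componentwise product on a tensor power *)

Section TensorAlgebra.
Variables (K : fieldType) (H : algType K) (n : nat).

Let mul2 (u v : n.-tuple H) := [tuple tnth u i * tnth v i | i < n].

Lemma tpure_mul_multilinearr u :
  multilinear (fun v => tpure (mul2 u v)).
Proof.
have E w i x : mul2 u (tset w i x) = tset (mul2 u w) i (tnth u i * x).
  by apply: eq_from_tnth => j; rewrite !tnth_mktuple; case: eqP => [->|].
by move=> w i a x y; rewrite !E mulrDr -scalerAr tpure_multilinear.
Qed.

Lemma tpure_mul_multilinearl v :
  multilinear (fun u => tpure (mul2 u v)).
Proof.
have E w i x : mul2 (tset w i x) v = tset (mul2 w v) i (x * tnth v i).
  by apply: eq_from_tnth => j; rewrite !tnth_mktuple; case: eqP => [->|].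
by move=> w i a x y; rewrite !E mulrDl -scalerAl tpure_multilinear.
Qed.

Lemma tmul_linearl (y : tpow n H) : linear (fun x => tmul x y).
Proof.
apply/tlift_linear/multilinear_tliftr => [u|v].
  exact: tpure_mul_multilinearr.
exact: tpure_mul_multilinearl.
Qed.

Lemma tmul_linearr (x : tpow n H) : linear (tmul x).
Proof.
apply: tlift_param => u; apply/tlift_linear; exact: tpure_mul_multilinearr.
Qed.

Definition tone : tpow n H := tpure [tuple 1 | i < n].

Lemma tpure_bigmul (I : Type) (r : seq I) (u : I -> n.-tuple H) :
  \big[@tmul K H n/tone]_(j <- r) tpure (u j) =
  tpure [tuple \prod_(j <- r) tnth (u j) i | i < n].
Proof.
elim: r => [|j r IHr]; rewrite ?big_nil ?big_cons ?IHr ?tmul_tpure;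
  apply: (congr1 (@tpure K n H)); apply: eq_from_tnth => i;
  by rewrite !tnth_mktuple ?big_nil ?big_cons.
Qed.

End TensorAlgebra.

(** Since [s] is a permutation, slot [i] enters exactly once, at position [k]. The bare operation
    [op] allows the use with [tmul]. *)
Lemma multilinear_big (K : fieldType) (V : lmodType K) (op : V -> V -> V)
    (idx : V) n (s : 'S_n) :
    (forall x, linear (op x)) -> (forall y, linear (op^~ y)) ->
  multilinear (fun u : n.-tuple V => \big[op/idx]_(j < n) tnth u (s j)).
Proof.
move=> opr opl u i a x y; pose k := (s^-1)%g i.
have sk : s k = i by rewrite permKV.
have uN z j : j != k -> tnth (tset u i z) (s j) = tnth u (s j).
  by move=> jk; rewrite tnth_mktuple -sk (inj_eq perm_inj) (negPf jk).
have uk z : tnth (tset u i z) (s k) = z by rewrite tnth_mktuple sk eqxx.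
(* The induction runs over duplicate-free lists containing [k]: if [k] is the head, the update
   leaves the remaining factors untouched. *)
have : k \in index_enum 'I_n by rewrite mem_index_enum.
elim: (index_enum _) (index_enum_uniq 'I_n) => //= j r IHr /andP[jr ur].
rewrite inE !big_cons; case: (eqVneq k j) => [kj _|kj /= kr]; last first.
  by rewrite !uN 1?eq_sym // IHr // opr.
have E z : \big[op/idx]_(l <- r) tnth (tset u i z) (s l) =
    \big[op/idx]_(l <- r) tnth u (s l).
  apply: eq_big_seq => l lr; rewrite uN //.
  by apply: contraNneq jr => lk; rewrite -kj -lk.
by rewrite !E -kj !uk opl.
Qed.

(** * Sweedler notation for a single comultiplication *)

Section Coalgebra.
Variables (K : fieldType) (H : bialgType K).

(** For bilinear [B] this is the Sweedler sum of [B h_(1) h_(2)]; nesting it expresses repeated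
    coproducts. *)
Definition sweedler2 (W : lmodType K) (B : H -> H -> W) (h : H) : W :=
  tlift (fun u : 2.-tuple H => B (tnth u ord0) (tnth u ord_max)) (comul h).

Lemma sweedler2_comp (W W' : lmodType K) (f : W -> W') (B : H -> H -> W) h :
  linear f -> f (sweedler2 B h) = sweedler2 (fun x y => f (B x y)) h.
Proof. exact: tlift_comp. Qed.

Lemma eq_sweedler2 (W : lmodType K) (B B' : H -> H -> W) h :
  B =2 B' -> sweedler2 B h = sweedler2 B' h.
Proof. by move=> BB'; apply: eq_tlift => u; rewrite BB'. Qed.

Lemma sweedler2_tpure h : sweedler2 (fun x y => tpure [tuple x; y]) h = comul h.
Proof.
have E (u : 2.-tuple H) : tpure [tuple tnth u ord0; tnth u ord_max] = tpure u.
  by case/tupleP: u => a u; case/tupleP: u => b u; rewrite (tuple0 u).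
by rewrite /sweedler2 (eq_tlift _ E) (tlift_pure (f := id)).
Qed.

Lemma sweedler2A (W : lmodType K) (G : H -> H -> H -> W) h :
    (forall x y, linear (G x y)) -> (forall x z, linear (fun y => G x y z)) ->
    (forall y z, linear (fun x => G x y z)) ->
  sweedler2 (fun x z => sweedler2 (fun x' y => G x' y z) x) h =
  sweedler2 (fun x y => sweedler2 (G x) y) h.
Proof.
move=> G3 G2 G1.
pose G' (x : H) (v : 2.-tuple H) := G x (tnth v ord0) (tnth v ord_max).
pose F (u : 3.-tuple H) := G' (thead u) [tuple of behead u].
have FM : multilinear F.
  apply: multilinear_cons => [x|v]; last exact: G1.
  exact: multilinear2.
(* The trilinear map, lifted to the third tensor power, is applied to the coassociativity axiom;
   each side is then computed separately. *)
have := congr1 (tlift F) (comulA h).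
have FL := tlift_linear FM.
rewrite (tlift_comp _ _ FL) (tlift_comp (V := H) _ _ FL).
have El (u : 2.-tuple H) :
    tlift F (tcat (comul (tnth u ord0)) (tpure [tuple tnth u ord_max])) =
    sweedler2 (fun x' y => G x' y (tnth u ord_max)) (tnth u ord0).
  rewrite (tlift_catr (m := 2) (n := 1) _ _ FM); apply: eq_tlift => v.
  by case/tupleP: v => a v; case/tupleP: v => b v; rewrite (tuple0 v).
have Er (u : 2.-tuple H) :
    tlift F (tcat (tpure [tuple tnth u ord0]) (comul (tnth u ord_max))) =
    sweedler2 (G (tnth u ord0)) (tnth u ord_max).
  rewrite (tlift_catl (m := 1) (n := 2) _ _ FM); apply: eq_tlift => v.
  by case/tupleP: v => a v; case/tupleP: v => b v; rewrite (tuple0 v).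
by rewrite (eq_tlift _ El) (eq_tlift _ Er).
Qed.

Lemma tpure1_linear : linear (fun x : H => tpure [tuple x]).
Proof. exact: (multilinear_consl [tuple] (@tpure_multilinear K 1 H)). Qed.

Lemma tpure2_linearl y : linear (fun x : H => tpure [tuple x; y]).
Proof. exact: (multilinear_consl [tuple y] (@tpure_multilinear K 2 H)). Qed.

Lemma tpure2_linearr x : linear (fun y : H => tpure [tuple x; y]).
Proof.
exact: (multilinear_consl [tuple]
  (multilinear_consr x (@tpure_multilinear K 2 H))).
Qed.

Lemma icomul_linear n : linear (@icomul K H n).
Proof.
case: n => [|n]; first by move=> a x y /=; rewrite linearP scalerDl scalerA.
elim: n => [|n IHn]; first exact: tpure1_linear.
apply: linear_comp IHn; apply/tlift_linear; exact: comul_tcat_multilinear.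
Qed.

End Coalgebra.

(** * Splitting and multiplicativity of the iterated comultiplication *)

Section IteratedComultiplication.
Variables (K : fieldType) (H : bialgType K).

Local Notation icomulH n := (@icomul K H n).

Lemma tcat_pure_comul2 n x y (z : tpow n H) :
  tcat (tpure [tuple x; y]) z =
  tcat (tpure [tuple x] : tpow 1 H) (tcat (tpure [tuple y]) z).
Proof.
rewrite -(tcat1A (m := 1)) tcat_tpure.
by apply: (congr1 (fun u : 2.-tuple H => tcat (tpure u) z)); apply: val_inj.
Qed.

(** By definition [icomul] keeps splitting the first factor; coassociativity allows splitting the
    second one instead, which suits induction on tuples. *)
Lemma icomul_cons n h :
  icomulH n.+1 h =
  sweedler2 (fun x y => tcat (tpure [tuple x]) (icomulH n y)) h.
Proof.
have IL k : linear (icomulH k) by exact: icomul_linear.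
have L1 := @tpure1_linear K H.
elim: n h => [|n IHn] h.
  (* For [n = 0] the tail is only the scalar [counit] of the second factor, and [counitr] collapses
     the sum. *)
  have E (u : 2.-tuple H) :
      tcat (tpure [tuple tnth u ord0]) (icomulH 0 (tnth u ord_max)) =
      tpure [tuple (counit (tnth u ord_max) : K) *: tnth u ord0].
    rewrite (linear_scale _ _ L1) (linear_scale _ _ (tcat_linearr _)).
    congr (_ *: _); rewrite tcat_tpure.
    by apply: (congr1 (@tpure K 1 H)); apply: val_inj.
  rewrite /sweedler2 (eq_tlift _ E).
  by rewrite -(tlift_comp (n := 2) _ _ L1) counitr.
pose Delta (u : n.+1.-tuple H) :=
  tcat (comul (thead u)) (tpure [tuple of behead u]).
have DM : multilinear Delta by exact: comul_tcat_multilinear.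
transitivity (tlift Delta (icomulH n.+1 h)); first by [].
rewrite IHn (sweedler2_comp _ _ (tlift_linear DM)).
(* [Delta] splits [x] and leaves the tail built from [y] alone. Coassociativity moves this splitting
   from [x] to [y], where the induction hypothesis absorbs it. *)
transitivity (sweedler2 (fun x y => sweedler2 (fun x' y' =>
  tcat (tpure [tuple x'; y']) (icomulH n y)) x) h).
  apply: eq_sweedler2 => x y.
  rewrite (tlift_catl (m := 1) _ _ DM).
  rewrite -(sweedler2_comp _ _ (tcat_linearl _)) sweedler2_tpure.
  rewrite -(tlift_pure _ (tcat_linearr _)); apply: eq_tlift => u.
  by apply: (congr1 (fun v => tcat (comul x) (tpure v))); apply: val_inj.
rewrite (sweedler2A (G := fun x' y' y =>
    tcat (tpure [tuple x'; y']) (icomulH n y))).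
- apply: eq_sweedler2 => x y; rewrite IHn.
  rewrite (sweedler2_comp _ _ (tcat_linearr _)).
  by apply: eq_sweedler2 => x' y'; rewrite tcat_pure_comul2.
- by move=> x y; apply: linear_comp; [exact: tcat_linearr|exact: IL].
- move=> x z.
  exact: (linear_comp (tcat_linearl (icomulH n z)) (tpure2_linearr x)).
- move=> y z.
  exact: (linear_comp (tcat_linearl (icomulH n z)) (tpure2_linearl y)).
Qed.

(** Induction on [m]: the left counit axiom gives [m = 0]; in the step, the first factor is taken
    out by [icomul_cons] and the rest regrouped by coassociativity. *)
Lemma icomulD m n h :
  icomulH (m + n) h =
  sweedler2 (fun x y => tcat (icomulH m x) (icomulH n y)) h.
Proof.
have IL k : linear (icomulH k) by exact: icomul_linear.
have L1 := @tpure1_linear K H.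
elim: m h => [|m IHm] h.
  rewrite -{1}(counitl h) (tlift_comp (n := 2) _ _ (IL _)).
  apply: eq_tlift => u.
  rewrite (linear_scale _ _ (IL n)) (linear_scale _ _ (tcat_linearl _)).
  by rewrite tcat0l.
transitivity (icomulH (m + n).+1 h); first by [].
rewrite icomul_cons.
transitivity (sweedler2 (fun x y => sweedler2 (fun y' z =>
    tcat (tpure [tuple x] : tpow 1 H) (tcat (icomulH m y') (icomulH n z))) y)
  h).
  apply: eq_sweedler2 => x y; rewrite IHm.
  exact: (sweedler2_comp _ y (tcat_linearr (tpure [tuple x]))).
rewrite -(sweedler2A (G := fun x y z =>
    tcat (tpure [tuple x] : tpow 1 H) (tcat (icomulH m y) (icomulH n z)))).
- apply: eq_sweedler2 => x z; rewrite icomul_cons.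
  rewrite (sweedler2_comp _ _ (tcat_linearl _)).
  by apply: eq_sweedler2 => x' y; rewrite tcat1A.
- move=> x y; apply: (linear_comp (f := tcat _)); first exact: tcat_linearr.
  by apply: linear_comp; [exact: tcat_linearr|exact: IL].
- move=> x z; apply: (linear_comp (f := tcat _)); first exact: tcat_linearr.
  exact: (linear_comp (tcat_linearl (icomulH n z)) (IL m)).
- move=> y z.
  exact: (linear_comp (tcat_linearl (tcat (icomulH m y) (icomulH n z))) L1).
Qed.

Lemma tcat_icomul_multilinear n : multilinear (fun u : 2.-tuple H =>
  tcat (tpure [tuple tnth u ord0]) (icomulH n (tnth u ord_max))).
Proof.
apply: (multilinear2 (B := fun x y => tcat (tpure [tuple x]) (icomulH n y))).
  move=> x; apply: (linear_comp (f := tcat _)); first exact: tcat_linearr.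
  exact: icomul_linear.
move=> y.
exact: (linear_comp (tcat_linearl (icomulH n y)) (@tpure1_linear K H)).
Qed.

Lemma icomul1 n : icomulH n 1 = tone H n.
Proof.
elim: n => [|n IHn].
  rewrite /icomul /= rmorph1 scale1r; apply: (congr1 (@tpure K 0 H)).
  by apply: eq_from_tnth => -[].
rewrite icomul_cons /sweedler2 comul1.
rewrite (tlift_tpure _ (tcat_icomul_multilinear n)).
rewrite IHn tcat_tpure cat1_tuple; apply: (congr1 (@tpure K n.+1 H)).
apply: eq_from_tnth => i; rewrite tnth_mktuple.
case: (unliftP ord0 i) => [j ->|->] //.
by rewrite tnthS tnth_mktuple.
Qed.

Lemma tmul_tcat1 n x y (z w : tpow n H) :
  tmul (tcat (tpure [tuple x] : tpow 1 H) z)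
    (tcat (tpure [tuple y] : tpow 1 H) w) =
  tcat (tpure [tuple x * y] : tpow 1 H) (tmul z w).
Proof.
pose X : tpow 1 H := tpure [tuple x]; pose Y : tpow 1 H := tpure [tuple y].
move: z; apply: tpow_ext => [||u].
- exact: (linear_comp (tmul_linearl (tcat Y w)) (tcat_linearr X)).
- exact: (linear_comp (tcat_linearr _) (tmul_linearl _)).
move: w; apply: tpow_ext => [||v].
- exact: (linear_comp (tmul_linearr _) (tcat_linearr Y)).
- exact: (linear_comp (tcat_linearr _) (tmul_linearr _)).
have E a (w : n.-tuple H) : tcat (tpure [tuple a] : tpow 1 H) (tpure w) =
    tpure [tuple of a :: w] :> tpow n.+1 H.
  by rewrite tcat_tpure cat1_tuple.
(* The steps are chained by [etrans] so that [1 + n] and [n.+1] are identified by conversion. *)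
apply: etrans (congr2 (@tmul K H n.+1) (E x u) (E y v)) _.
apply: etrans (esym (congr1 (tcat (tpure [tuple x * y])) (tmul_tpure u v))).
apply: etrans (tmul_tpure (n := n.+1) _ _) (etrans _ (esym (E _ _))).
apply: (congr1 (@tpure K n.+1 H)).
apply: eq_from_tnth => i; rewrite tnth_mktuple.
case: (unliftP ord0 i) => [j ->|->] //.
by rewrite !tnthS tnth_mktuple.
Qed.

(** Induction on [n], from the multiplicativity of [counit] and of [comul]. *)
Lemma icomulM n g h : icomulH n (g * h) = tmul (icomulH n g) (icomulH n h).
Proof.
have IL k : linear (icomulH k) by exact: icomul_linear.
elim: n g h => [|n IHn] g h.
  rewrite /icomul /= rmorphM (linear_scale _ _ (tmul_linearl _)).
  rewrite (linear_scale _ _ (tmul_linearr (tpure [tuple]))) scalerA tmul_tpure.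
  congr (_ *: _); apply: (congr1 (@tpure K 0 H)).
  by apply: eq_from_tnth => -[].
pose Phi (u : 2.-tuple H) : tpow n.+1 H :=
  tcat (tpure [tuple tnth u ord0]) (icomulH n (tnth u ord_max)).
have PM : multilinear Phi by exact: tcat_icomul_multilinear.
have PL := tlift_linear PM.
(* [tlift Phi] is the identity tensored with [icomul n]; its multiplicativity is checked on pure
   tensors, by the induction hypothesis in the second factor. *)
suff E x y : tlift Phi (tmul x y) = tmul (tlift Phi x) (tlift Phi y).
  by rewrite !icomul_cons /sweedler2 comulM E.
move: x; apply: tpow_ext => [||u].
- exact: (linear_comp PL (tmul_linearl _)).
- exact: (linear_comp (tmul_linearl _) PL).
move: y; apply: tpow_ext => [||v].
- exact: (linear_comp PL (tmul_linearr _)).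
- exact: (linear_comp (tmul_linearr _) PL).
by rewrite tmul_tpure !tlift_tpure // /Phi tmul_tcat1 !tnth_mktuple IHn.
Qed.

End IteratedComultiplication.

(** * Juxtaposition of [n] blocks of length [m] *)

Fixpoint tuple_flatten (T : Type) m n :
    n.-tuple (m.-tuple T) -> (n * m).-tuple T :=
  match n with
  | 0 => fun=> [tuple]
  | n'.+1 => fun u =>
      [tuple of thead u ++ tuple_flatten [tuple of behead u]]
  end.

Lemma tnth_flatten (T : Type) m n (u : n.-tuple (m.-tuple T)) (i : 'I_n)
    (j : 'I_m) (k : 'I_(n * m)) :
  k = (i * m + j)%N :> nat -> tnth (tuple_flatten u) k = tnth (tnth u i) j.
Proof.
elim: n u i k => [|n IHn] u i k; first by case: i.
case/tupleP: u => x u kE; rewrite /= theadE behead_cons.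
case: (unliftP ord0 i) kE => [i' ->|->]; rewrite ?tnthS ?tnth0 => kE.
  have k'P : (i' * m + j < n * m)%N.
    by rewrite (leq_trans (n := i'.+1 * m)) ?leq_mul2r ?ltn_ord ?orbT //
      mulSnr ltn_add2l.
  have -> : k = rshift m (Ordinal k'P) :> 'I_(m + n * m).
    by apply: val_inj; rewrite /= kE lift0 mulSn addnA.
  by rewrite tnth_rshift (IHn _ i').
have -> : k = lshift (n * m) j :> 'I_(m + n * m) by apply: val_inj; apply: kE.
by rewrite tnth_lshift.
Qed.

Section BigTcat.
Variables (K : fieldType) (V : lmodType K) (m : nat).

(** The recursion parallels [tuple_flatten]; the length [n'.+1 * m] unfolds to [m + n' * m], so no
    cast occurs. *)
Fixpoint big_tcat n : n.-tuple (tpow m V) -> tpow (n * m) V :=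
  match n with
  | 0 => fun=> tpure [tuple]
  | n'.+1 => fun x => tcat (thead x) (big_tcat [tuple of behead x])
  end.

Lemma big_tcat_multilinear n : multilinear (@big_tcat n).
Proof.
elim: n => [|n IHn]; first exact: multilinear0.
apply: (multilinear_cons (g := fun x v => tcat x (big_tcat v))) => [x|v].
  by move=> u i a y z; rewrite IHn; apply: tcat_linearr.
exact: tcat_linearl.
Qed.

Lemma big_tcat_tpure n (u : n.-tuple (m.-tuple V)) :
  big_tcat [tuple of map (@tpure K m V) u] = tpure (tuple_flatten u).
Proof.
elim: n u => [|n IHn] u //; case/tupleP: u => x u.
transitivity (tcat (tpure x) (big_tcat [tuple of map (@tpure K m V) u])).
  by apply: (congr1 (fun v => tcat (tpure x) (big_tcat v))); apply: val_inj.
rewrite IHn tcat_tpure; apply: (congr1 (@tpure K _ V)).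
by rewrite /= theadE behead_cons.
Qed.

End BigTcat.

(** The factors keep their order, as [R] may be noncommutative. A separate [N] lets the product
    range over ['I_(n * m)] while being cut into [m] runs of [n] factors. *)
Lemma prod_ord_mul (R : pzRingType) m n N (F : 'I_N -> R)
    (G : 'I_m -> 'I_n -> R) : N = (m * n)%N ->
    (forall (k : 'I_N) (i : 'I_m) (j : 'I_n),
      k = (i * n + j)%N :> nat -> F k = G i j) ->
  \prod_(k < N) F k = \prod_(i < m) \prod_(j < n) G i j.
Proof.
move=> NE; elim: m N NE F G => [|m IHm] N NE F G FG; subst N.
  by rewrite !big_ord0.
apply: etrans (@big_split_ord _ _ _ n (m * n) predT F) _.
rewrite big_ord_recl /=; congr (_ * _).
  by apply: eq_bigr => j _; apply: FG.
apply: IHm => // k i j kE; apply: FG.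
by rewrite [LHS]/= kE lift0 mulSn addnA.
Qed.

(** * Sweedler powers and the product of permutations *)

Section SweedlerPowers.
Variables (K : fieldType) (H : bialgType K).

(** Induction on [n]: [icomulD] separates a first block of length [m], matching the head in
    [icomul_cons]. For [n = 0] both sides are [counit h] times the empty tensor. *)
Lemma icomul_mul m n (h : H) :
  icomul (n * m) h =
  tlift (fun u : n.-tuple H => big_tcat [tuple of map (@icomul K H m) u])
    (icomul n h).
Proof.
have IL k := @icomul_linear K H k.
have FM k : multilinear (fun u : k.-tuple H =>
    big_tcat [tuple of map (@icomul K H m) u]).
  exact: (multilinear_map (IL m) (@big_tcat_multilinear K H m k)).
elim: n h => [|n IHn] h.
  by rewrite (linear_scale _ _ (tlift_linear (FM 0%N))) tlift_tpure.
rewrite icomul_cons (sweedler2_comp _ _ (tlift_linear (FM n.+1))).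
transitivity (icomul (m + n * m) h); first by [].
rewrite icomulD; apply: eq_sweedler2 => x y.
rewrite (tlift_catl (m := 1) _ _ (FM n.+1)) IHn.
rewrite (tlift_comp _ _ (tcat_linearr (icomul m x))).
apply: eq_tlift => u.
by apply: (congr1 (fun v => tcat (icomul m x) (big_tcat v))); apply: val_inj.
Qed.

(* n juxtaposed blocks of length m are indexed by 'I_(n * m), whereas perm_dot
   acts on 'I_(m * n). *)
Lemma sweedler_power_cast n n' (e : n = n') (s : 'S_n) (h : H) :
  sweedler_power (cast_perm e s) h = sweedler_power s h.
Proof. by case: n' / e; rewrite cast_perm_id. Qed.

(** Both sides are multilinear in the blocks, so these may be taken pure; what remains is an
    identity of ordered products in [H]. *)
Lemma sweedler_big_tcat n m (s : 'S_n) (t : 'S_m) (x : n.-tuple (tpow m H)) :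
  tlift (fun w : m.-tuple H => \prod_(i < m) tnth w (t i))
    (\big[@tmul K H m/tone H m]_(j < n) tnth x (s j)) =
  tlift (fun w : (n * m).-tuple H =>
    \prod_(k < n * m) tnth w (cast_perm (mulnC m n) (perm_dot s t) k))
    (big_tcat x).
Proof.
have tM := @sweedler_prod_multilinear K H m t.
have stM := @sweedler_prod_multilinear K H _
  (cast_perm (mulnC m n) (perm_dot s t)).
move: x; apply: multilinear_ext => [||u].
- have M := multilinear_big (tone H m) s (@tmul_linearr K H m)
    (@tmul_linearl K H m).
  by move=> u i a x y; rewrite M; apply: tlift_linear.
- move=> u i a x y; rewrite big_tcat_multilinear; exact: tlift_linear.
rewrite big_tcat_tpure tlift_tpure //.
under eq_bigr do rewrite tnth_map.
rewrite tpure_bigmul tlift_tpure //; symmetry.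
under [RHS]eq_bigr do rewrite tnth_mktuple.
(* The index [i * n + j] is sent to [s j * m + t i], the place of component [t i] of block [s j] in
   the flattened tuple. *)
apply: (prod_ord_mul (G := fun i j => tnth (tnth u (s j)) (t i))).
  exact: mulnC.
move=> k i j kE; apply: tnth_flatten; rewrite cast_permE /=.
exact: perm_dotE.
Qed.

End SweedlerPowers.

Theorem proposition1p3 (K : fieldType) (H : bialgType K) (n m : nat)
    (n_gt0 : (0 < n)%N) (m_gt0 : (0 < m)%N) (s : 'S_n) (t : 'S_m) (h : H) :
  sweedler_power t (sweedler_power s h) = sweedler_power (perm_dot s t) h.
Proof.
rewrite -(sweedler_power_cast (mulnC m n)).
have tM := @sweedler_prod_multilinear K H m t.
have stM := @sweedler_prod_multilinear K H _
  (cast_perm (mulnC m n) (perm_dot s t)).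
rewrite [RHS]/sweedler_power icomul_mul (tlift_comp _ _ (tlift_linear stM)).
rewrite /sweedler_power (tlift_comp _ _ (@icomul_linear K H m)).
rewrite (tlift_comp _ _ (tlift_linear tM)).
(* Both sides are now lifts along the same [icomul n h], hence compared on each tuple [u]. *)
apply: eq_tlift => u; rewrite -sweedler_big_tcat.
(* Multiplicativity distributes [icomul m] over the product defining the [s]-th power. *)
rewrite (big_morph _ (@icomulM K H m) (icomul1 H m)).
by under [in RHS]eq_bigr do rewrite tnth_map.
Qed.
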